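(* Let $K$ be a finite simplicial complex and let $V$ be a finite set containing the set $K^0$ of vertices of $K$. Suppose that the nerve $N(K)$ strong collapses to $\dot\sigma$, where $\dot\sigma$ is the boundary of a simplex $\sigma$. Then $K$ simplicially collapses to $\dot\sigma$ (that is, to a subcomplex of $K$ isomorphic to $\dot\sigma$), and therefore the Alexander dual $K^*$ of $K$ with respect to $V$ is homotopy equivalent to a sphere.
   Context: Finite simplicial complexes are abstract: a finite family of finite sets closed under taking subsets. The empty set is regarded as a simplex of every simplicial complex. $K^0$ is the set of vertices of $K$. Given a finite set $V\supseteq K^0$, the Alexander dual of $K$ with respect to $V$ is $K^*=\{\sigma\subseteq V : V\smallsetminus\sigma\notin K\}$. The nerve $N(K)$ is the simplicial complex whose vertices are the (nonempty) maximal simplices (facets) of $K$ and whose simplices are the sets of facets with non-empty common intersection. Strong collapses: for a vertex $v$ of $K$, $K\smallsetminus v$ denotes the full subcomplex of $K$ spanned by the vertices different from $v$. There is an elementary strong collapse from $K$ to $K\smallsetminus v$ if the link $lk(v,K)$ is a simplicial cone $v'L$ for some vertex $v'$ (with $L$ possibly having no vertices); in this case $v$ is said to be dominated by $v'$. There is a strong collapse from $K$ to a subcomplex $L$ if there is a finite (possibly empty) sequence of elementary strong collapses that starts in $K$ and ends in $L$. Simplicial collapses: there is an elementary simplicial collapse from $K$ to a subcomplex $L$ if $L=K\smallsetminus\{\tau,\sigma\}$, where $\tau$ is a nonempty free face of $\sigma$ in $K$ (that is, $\dim\tau=\dim\sigma-1$ and $\sigma$ is the only simplex of $K$ properly containing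 $\tau$); $K$ simplicially collapses to $L$ if there is a finite (possibly empty) sequence of elementary simplicial collapses from $K$ to $L$. The boundary $\dot\sigma$ of a simplex $\sigma$ is the complex of all proper faces of $\sigma$; collapsing to $\dot\sigma$ means collapsing to a subcomplex isomorphic to $\dot\sigma$. Homotopy equivalence refers to geometric realizations. The complex $\{\emptyset\}$, whose realization is empty, is regarded as the sphere $S^{-1}$. *)

(* Defs.v *)
From HB Require Import structures.
From mathcomp Require Import all_boot all_order all_algebra.

Set Implicit Arguments.
Unset Strict Implicit.
Unset Printing Implicit Defensive.

(* A simplicial complex with vertices in T is a family K : {set {set T}} for
   which simplicial_complex K holds.  The vertices of K are the points v with
   [set v] \in K; they need not exhaust T. *)
Definition simplicial_complex (T : finType) (K : {set {set T}}) : bool :=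
  (set0 \in K) && [forall s in K, powerset s \subset K].

Definition vertices (T : finType) (K : {set {set T}}) : {set T} :=
  [set v | [set v] \in K].

(* When the family K contains every subset of V, the dual is the empty family,
   which does not even contain the empty simplex. *)
Definition alexander_dual (T : finType) (V : {set T}) (K : {set {set T}}) :
    {set {set T}} :=
  [set s : {set T} | (s \subset V) && (V :\: s \notin K)].

Definition facets (T : finType) (K : {set {set T}}) : {set {set T}} :=
  [set s : {set T} | maxset [pred t : {set T} | t \in K] s & s != set0].

(* The disjunct F == set0 is needed: an empty intersection is [set: T], which
   is set0 when T is empty. *)
Definition nerve (T : finType) (K : {set {set T}}) : {set {set {set T}}} :=
  [set F : {set {set T}} | (F \subset facets K) &&
     ((F == set0) || (\bigcap_(s in F) s != set0))].

Definition boundary (T : finType) (s : {set T}) : {set {set T}} :=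
  [set t : {set T} | t \proper s].

Definition isomorphic (T U : finType) (K : {set {set T}}) (L : {set {set U}}) :
    Prop :=
  exists f : {x | x \in vertices K} -> {y | y \in vertices L},
    bijective f /\
    forall s : {set {x | x \in vertices K}},
      ([set val x | x in s] \in K) = ([set val (f x) | x in s] \in L).

Definition link (T : finType) (v : T) (K : {set {set T}}) : {set {set T}} :=
  [set s in K | (v \notin s) && (v |: s \in K)].

Definition deletion (T : finType) (v : T) (K : {set {set T}}) :
    {set {set T}} :=
  [set s in K | v \notin s].

Definition cone (T : finType) (v : T) (L : {set {set T}}) : {set {set T}} :=
  L :|: [set v |: s | s in L].

Definition vertex_dominated (T : finType) (K : {set {set T}}) (v w : T) : bool :=
  [exists L : {set {set T}},
     [&& simplicial_complex L, w \notin vertices L & link v K == cone w L]].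

Definition elementary_strong_collapse (T : finType) : rel {set {set T}} :=
  fun K L => [exists v in vertices K,
    [exists w, vertex_dominated K v w] && (L == deletion v K)].

Definition strong_collapse (T : finType) : rel {set {set T}} :=
  connect (@elementary_strong_collapse T).

Definition free_face (T : finType) (K : {set {set T}}) (t s : {set T}) : bool :=
  [&& t \in K, s \in K, t \proper s, #|s| == #|t|.+1
    & [forall r in K, (t \proper r) ==> (r == s)]].

Definition elementary_collapse (T : finType) : rel {set {set T}} :=
  fun K L => [exists t : {set T}, exists s : {set T},
    [&& t != set0, free_face K t s & L == K :\: [set t; s]]].

Definition simplicial_collapse (T : finType) : rel {set {set T}} :=
  connect (@elementary_collapse T).

Definition strong_collapses_to (T U : finType)
    (K : {set {set T}}) (L : {set {set U}}) : Prop :=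
  exists2 L' : {set {set T}}, strong_collapse K L' & isomorphic L' L.

Definition collapses_to (T U : finType)
    (K : {set {set T}}) (L : {set {set U}}) : Prop :=
  exists2 L' : {set {set T}}, simplicial_collapse K L' & isomorphic L' L.

From mathcomp Require Import all_classical all_reals all_analysis.
Import Order.TTheory GRing.Theory Num.Theory.
Import numFieldNormedType.Exports.

Local Open Scope ring_scope.
Local Open Scope classical_set_scope.

(* Barycentric coordinates; the support is automatically nonempty, so the
   realizations of [set set0] and of the empty family are both empty. *)
Definition realization_set (R : realType) (T : finType) (K : {set {set T}}) :
    set {ptws T -> R} :=
  [set x : {ptws T -> R} | [/\ forall v, 0 <= x v, \sum_(v : T) x v = 1
                             & [set v | x v != 0]%SET \in K]].
Arguments realization_set R {T} K.

Definition realization (R : realType) (T : finType) (K : {set {set T}}) :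
    topologicalType :=
  set_type (realization_set R K).
Arguments realization R {T} K.

(* The unit sphere of R^n is S^(n-1); for n = 0 it is empty. *)
Definition unit_sphere (R : realType) (n : nat) : topologicalType :=
  set_type [set x : 'rV[R]_n | \sum_(i < n) x ord0 i ^+ 2 = 1].

Definition homotopic (R : realType) (X Y : topologicalType) (f g : X -> Y) :
    Prop :=
  exists H : R * X -> Y,
    [/\ {within `[0, 1] `*` setT, continuous H},
        forall x, H (0, x) = f x & forall x, H (1, x) = g x].

Definition homotopy_equivalent (R : realType) (X Y : topologicalType) : Prop :=
  exists (f : X -> Y) (g : Y -> X),
    [/\ continuous f, continuous g,
        homotopic R (g \o f) id & homotopic R (f \o g) id].

(* Main.v *)
(* A complex and its nerve are the two readings of one incidence relation
   (vertices against facets).  Strong collapses are invertible up to the homotopy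
   of relations below, and a relation without dominated rows or columns is rigid:
   only the identity is homotopic to the identity.  The relation of the boundary
   of a simplex is symmetric and rigid, so if N(K) strong collapses to a boundary
   then the core of K is the boundary of a simplex of the same dimension; thus K
   strong collapses, a fortiori collapses, to a boundary.

   Both a strong collapse K -> K - v and the inclusion K^* <= (K - v)^* of the
   duals are relative cones: the simplices lost are matched in pairs
   (s, s + w).  A relative cone is a homotopy equivalence, by an explicit
   deformation retraction.  Hence K^* is homotopy equivalent to the dual of the
   boundary of a simplex X, which is a relative cone over the boundary of
   (V - X) + w for any w in X, that is, over a sphere. *)

Require Import Defs.
From mathcomp Require Import all_boot all_order all_algebra zify.

Set Implicit Arguments.
Unset Strict Implicit.
Unset Printing Implicit Defensive.

(** * Homotopy of incidence relations *)

Definition rel_hom (P Q P' Q' : Type) (I : P -> Q -> bool) (J : P' -> Q' -> bool)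
    (h : P -> P') (g : Q -> Q') : Prop :=
  forall v F, I v F -> J (h v) (g F).

(** Two row maps that are homomorphisms with one column map [g] send each column [F] into the single
    column [g F]. A row step is thus contiguity of simplicial maps, and a column step is the same
    for the transposed relation. *)
Inductive rel_htpy (P Q P' Q' : Type) (I : P -> Q -> bool)
    (J : P' -> Q' -> bool) (h : P -> P') (g : Q -> Q') :
    (P -> P') -> (Q -> Q') -> Prop :=
| RelHtpyRefl : rel_htpy I J h g h g
| RelHtpyRow h1 g1 h2 :
    rel_htpy I J h g h1 g1 -> rel_hom I J h2 g1 -> rel_htpy I J h g h2 g1
| RelHtpyCol h1 g1 g2 :
    rel_htpy I J h g h1 g1 -> rel_hom I J h1 g2 -> rel_htpy I J h g h1 g2.

Definition rel_equiv (P Q P' Q' : Type) (I : P -> Q -> bool)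
    (J : P' -> Q' -> bool) : Prop :=
  exists h g h' g',
    [/\ rel_hom I J h g, rel_hom J I h' g',
        rel_htpy I I id id (h' \o h) (g' \o g)
      & rel_htpy J J id id (h \o h') (g \o g')].

Definition rel_tr (P Q : Type) (I : P -> Q -> bool) : Q -> P -> bool :=
  fun F v => I v F.

(** The incidence [I v F] in both clauses exempts points without incidences: the relations live on
    whole types, and points outside the complex must not matter. *)
Definition rel_minimal (P Q : Type) (I : P -> Q -> bool) : Prop :=
  (forall v w F, I v F -> (forall G, I v G -> I w G) -> w = v) /\
  (forall F G v, I v F -> (forall w, I w F -> I w G) -> G = F).

Lemma rel_htpy_trans (P Q P' Q' : Type) (I : P -> Q -> bool)
    (J : P' -> Q' -> bool) h g h1 g1 h2 g2 :
  rel_htpy I J h g h1 g1 -> rel_htpy I J h1 g1 h2 g2 -> rel_htpy I J h g h2 g2.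
Proof.
move=> H; elim=> [//|h3 g3 h4 _ H3 H4|h3 g3 g4 _ H3 H4].
- exact: RelHtpyRow H3 H4.
- exact: RelHtpyCol H3 H4.
Qed.

Lemma rel_htpy_postcomp (P Q P' Q' P2 Q2 : Type) (I : P -> Q -> bool)
    (J : P' -> Q' -> bool) (J2 : P2 -> Q2 -> bool) p q h g h1 g1 :
  rel_hom J J2 p q -> rel_htpy I J h g h1 g1 ->
  rel_htpy I J2 (p \o h) (q \o g) (p \o h1) (q \o g1).
Proof.
move=> Hpq; elim=> [|h3 g3 h4 _ H3 H4|h3 g3 g4 _ H3 H4].
- exact: RelHtpyRefl.
- by apply: RelHtpyRow H3 _ => v F /H4 /Hpq.
- by apply: RelHtpyCol H3 _ => v F /H4 /Hpq.
Qed.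

Lemma rel_htpy_precomp (P Q P' Q' P2 Q2 : Type) (I : P -> Q -> bool)
    (J : P' -> Q' -> bool) (J2 : P2 -> Q2 -> bool) p q h g h1 g1 :
  rel_hom J2 I p q -> rel_htpy I J h g h1 g1 ->
  rel_htpy J2 J (h \o p) (g \o q) (h1 \o p) (g1 \o q).
Proof.
move=> Hpq; elim=> [|h3 g3 h4 _ H3 H4|h3 g3 g4 _ H3 H4].
- exact: RelHtpyRefl.
- by apply: RelHtpyRow H3 _ => v F /Hpq /H4.
- by apply: RelHtpyCol H3 _ => v F /Hpq /H4.
Qed.

Lemma rel_equiv_sym (P Q P' Q' : Type) (I : P -> Q -> bool)
    (J : P' -> Q' -> bool) : rel_equiv I J -> rel_equiv J I.
Proof. by move=> [h [g [h' [g' [? ? ? ?]]]]]; exists h', g', h, g. Qed.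

Lemma rel_equiv_trans (P Q P' Q' P2 Q2 : Type) (I : P -> Q -> bool)
    (J : P' -> Q' -> bool) (J2 : P2 -> Q2 -> bool) :
  rel_equiv I J -> rel_equiv J J2 -> rel_equiv I J2.
Proof.
move=> [h [g [h' [g' [H1 H2 H3 H4]]]]] [p [q [p' [q' [G1 G2 G3 G4]]]]].
exists (p \o h), (q \o g), (h' \o p'), (g' \o q'); split.
- by move=> v F /H1 /G1.
- by move=> v F /G2 /H2.
- apply: rel_htpy_trans H3 _.
  exact: (rel_htpy_postcomp H2 (rel_htpy_precomp H1 G3)).
- apply: rel_htpy_trans G4 _.
  exact: (rel_htpy_postcomp G1 (rel_htpy_precomp G2 H4)).
Qed.

Lemma rel_htpy_tr (P Q P' Q' : Type) (I : P -> Q -> bool)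
    (J : P' -> Q' -> bool) h g h1 g1 :
  rel_htpy I J h g h1 g1 -> rel_htpy (rel_tr I) (rel_tr J) g h g1 h1.
Proof.
elim=> [|h3 g3 h4 _ H3 H4|h3 g3 g4 _ H3 H4].
- exact: RelHtpyRefl.
- by apply: RelHtpyCol H3 _ => v F /H4.
- by apply: RelHtpyRow H3 _ => v F /H4.
Qed.

Lemma rel_equiv_tr (P Q P' Q' : Type) (I : P -> Q -> bool)
    (J : P' -> Q' -> bool) :
  rel_equiv I J -> rel_equiv (rel_tr I) (rel_tr J).
Proof.
move=> [h [g [h' [g' [H1 H2 H3 H4]]]]]; exists g, h, g', h'; split.
- by move=> v F /H1.
- by move=> v F /H2.
- exact: rel_htpy_tr H3.
- exact: rel_htpy_tr H4.
Qed.

(** Both composites are the identity on rows, so a single column step joins each of them to the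
    identity. *)
Lemma rel_equiv_cols (P Q Q' : Type) (I : P -> Q -> bool)
    (J : P -> Q' -> bool) (g : Q -> Q') (g' : Q' -> Q) :
  rel_hom I J id g -> rel_hom J I id g' -> rel_equiv I J.
Proof.
move=> H H'; exists id, g, id, g'; split => //.
- by apply: RelHtpyCol (RelHtpyRefl _ _ _ _) _ => v F /H /H'.
- by apply: RelHtpyCol (RelHtpyRefl _ _ _ _) _ => v F /H' /H.
Qed.

(** Induction along the homotopy. While the column map fixes every incident column, a new row map
    sends [v] to a point lying on every column through [v]; minimality forces that point to be [v].
    Columns are dual. *)
Lemma rel_minimal_rigid (P Q : Type) (I : P -> Q -> bool) h g :
  rel_minimal I -> rel_htpy I I id id h g ->
  forall v F, I v F -> h v = v /\ g F = F.
Proof.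
move=> [minr minc]; elim=> [//|h1 g1 h2 _ IH H|h1 g1 g2 _ IH H] v F vF.
- split; last by have [] := IH _ _ vF.
  by apply: minr vF _ => G vG; have [_ <-] := IH _ _ vG; apply: H.
- split; first by have [] := IH _ _ vF.
  by apply: minc vF _ => w wF; have [<- _] := IH _ _ wF; apply: H.
Qed.

(** * Incidence relations of complexes and nerves *)

Section Complexes.
Variable T : finType.
Implicit Types (K L X Y : {set {set T}}) (s t F : {set T}) (v w : T).

Lemma complexP K :
  reflect (set0 \in K /\ forall s t, s \in K -> t \subset s -> t \in K)
          (simplicial_complex K).
Proof.
apply: (iffP andP) => [[K0 /forall_inP KS]|[K0 KS]]; split=> //.
  by move=> s t sK ts; apply: (subsetP (KS s sK)); rewrite powersetE.
apply/forall_inP => s sK; apply/subsetP => t; rewrite powersetE.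
exact: KS.
Qed.

Lemma mem_vertices K s v :
  simplicial_complex K -> s \in K -> v \in s -> v \in vertices K.
Proof.
by move=> /complexP[_ KS] sK vs; rewrite inE; apply: KS sK _; rewrite sub1set.
Qed.

Lemma deletion_complex K v :
  simplicial_complex K -> simplicial_complex (deletion v K).
Proof.
move=> /complexP[K0 KS]; apply/complexP; split; first by rewrite !inE K0.
move=> s t; rewrite !inE => /andP[sK vs] ts; rewrite (KS s t) //=.
by apply: contra vs; apply: (subsetP ts).
Qed.

Lemma vertex_dominatedP K v w : simplicial_complex K -> v \in vertices K ->
  reflect (v != w /\ forall s, s \in K -> v \in s -> w |: s \in K)
          (vertex_dominated K v w).
Proof.
move=> cK; have /complexP[K0 KS] := cK; rewrite inE => vK.
apply: (iffP existsP) => [[L /and3P[cL wL /eqP linkE]]|[vw Hw]].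
  have /complexP[L0 LS] := cL; split.
    have : w |: set0 \in link v K.
      by rewrite linkE !inE; apply/orP; right; apply: imset_f.
    by rewrite !inE => /and3P[_ + _]; apply: contra => /eqP->; rewrite eqxx.
  move=> s sK vs.
  have : s :\ v \in link v K by rewrite !inE eqxx /= setD1K // sK (KS s) ?subD1set.
  have wlink t : t \in L -> v |: (w |: t) \in K.
    move=> tL; have : w |: t \in link v K.
      by rewrite linkE !inE; apply/orP; right; apply: imset_f.
    by rewrite inE => /and3P[].
  rewrite linkE !inE => /orP[sL|/imsetP[t tL st]].
    by have := wlink _ sL; rewrite setUCA setD1K.
  rewrite -(setD1K vs) st setUCA [w |: (w |: t)]setUA setUid; exact: wlink.
exists [set s in link v K | w \notin s]; apply/and3P; split.
- apply/complexP; split; first by rewrite !inE K0 setU0 vK.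
  move=> s t; rewrite !inE => /andP[/and3P[sK vs vsK] ws] ts.
  have nt u : u \notin s -> u \notin t by apply/contra/(subsetP ts).
  rewrite (nt v) ?(nt w) // !andbT (KS s t) //=; apply: KS vsK _; exact: setUS.
- by rewrite !inE eqxx andbF.
apply/eqP/setP => s; apply/idP/idP.
  rewrite [in X in _ -> X]inE => sl.
  case: (boolP (w \in s)) => ws; last by rewrite inE sl ws.
  apply/orP; right; apply/imsetP; exists (s :\ w); last by rewrite setD1K.
  move: sl; rewrite !inE eqxx andbT (negbTE vw) /= => /and3P[sK vs vsK].
  by rewrite (KS s) ?subD1set //= vs (KS _ _ vsK) ?setUS ?subD1set.
rewrite inE => /orP[|/imsetP[t]]; first by rewrite inE => /andP[].
rewrite !inE => /andP[/and3P[tK vt vtK] wt] ->.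
have H : w |: (v |: t) \in K by rewrite Hw // setU11.
by rewrite setUCA H !inE (negbTE vw) /= vt (KS _ _ H) // setUS // subsetUr.
Qed.

Lemma facetsP K F :
  reflect [/\ F \in K, F != set0 & forall s, s \in K -> F \subset s -> s = F]
          (F \in facets K).
Proof.
rewrite inE; apply: (iffP andP) => [[/maxsetP[FK Fmax] F0]|[FK F0 Fmax]].
  by split.
by split=> //; apply/maxsetP; split.
Qed.

Lemma facet_exists K s : s \in K -> s != set0 ->
  {F | F \in facets K & s \subset F}.
Proof.
move=> sK s0.
have [F Fmax sF] := @maxset_exists _ [pred t | t \in K] s sK.
exists F => //; rewrite inE Fmax; apply: contra s0 => /eqP F0.
by rewrite -subset0 -F0.
Qed.

End Complexes.

Section ComplexRelations.
Variable T : finType.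
Implicit Types (K L X Y : {set {set T}}) (s t F : {set T}) (v w : T).

Lemma nerve_complex K : simplicial_complex (nerve K).
Proof.
apply/complexP; split; first by rewrite inE sub0set eqxx.
move=> A B; rewrite !inE => /andP[AK AI] BA; rewrite (subset_trans BA AK) /=.
case: eqVneq => //= B0; case/orP: AI => [/eqP A0|].
  by move: BA; rewrite A0 subset0 (negbTE B0).
apply: contra; rewrite -!subset0; apply: subset_trans.
by apply/bigcapsP => s sB; apply: bigcap_inf; apply: (subsetP BA).
Qed.

Definition complex_rel K v s : bool := (s \in K) && (v \in s).

Definition facet_rel K v F : bool := (F \in facets K) && (v \in F).

Lemma complex_rel_facet_rel K : rel_equiv (complex_rel K) (facet_rel K).
Proof.
pose top s := odflt s [pick F | (F \in facets K) && (s \subset F)].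
apply: (@rel_equiv_cols _ _ _ _ _ top id).
- move=> v s /andP[sK vs] /=; rewrite /facet_rel /top.
  case: pickP => [F /andP[-> sF]|H] /=; first exact: subsetP vs.
  have s0 : s != set0 by apply/set0Pn; exists v.
  by have [F FK sF] := facet_exists sK s0; have := H F; rewrite FK sF.
- by move=> v F /andP[/facetsP[FK _ _] vF]; rewrite /complex_rel FK.
Qed.

(** The inverse of the inclusion is the retraction sending [v] to [w]. It is joined to the identity
    in three steps: enlarge [s] to [s :|: rs s], a simplex by domination, then move the points by
    [r], then shrink the column to [rs s]. *)
Lemma deletion_complex_rel K v w :
  simplicial_complex K -> v \in vertices K -> vertex_dominated K v w ->
  rel_equiv (complex_rel K) (complex_rel (deletion v K)).
Proof.
move=> cK vK /(vertex_dominatedP _ cK vK)[vw domw].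
have /complexP[_ KS] := cK.
pose r u := if u == v then w else u; pose rs s := r @: s.
have rsV s : v \notin s -> rs s = s.
  move=> vs; rewrite -[RHS]imset_id; apply: eq_in_imset => u us.
  by rewrite /r ifN //; apply: contra vs => /eqP <-.
have sub_rs s : s \in K -> s :|: rs s \in K.
  move=> sK; case: (boolP (v \in s)) => vs; last by rewrite rsV // setUid.
  apply: KS (domw _ sK vs) _; rewrite subUset subsetUr /=.
  apply/subsetP => _ /imsetP[u us ->]; rewrite /r !inE.
  by case: ifP; rewrite ?eqxx ?us ?orbT.
have vrs s : v \notin rs s.
  apply/imsetP => -[u _]; rewrite /r; case: eqP => [_ /eqP|uv /esym] //.
  by rewrite (negbTE vw).
exists r, rs, id, id; split.
- move=> u s /andP[sK us]; rewrite /complex_rel inE vrs andbT.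
  by rewrite (KS _ _ (sub_rs _ sK)) ?subsetUr //=; apply: imset_f.
- by move=> u s /andP[]; rewrite inE => /andP[sK _] us; rewrite /complex_rel sK.
- pose h0 := @RelHtpyRefl _ _ _ _ (complex_rel K) (complex_rel K) id id.
  have /(RelHtpyCol h0) h1 :
      rel_hom (complex_rel K) (complex_rel K) id (fun s => s :|: rs s).
    by move=> u s /andP[sK us]; rewrite /complex_rel sub_rs // inE us.
  have /(RelHtpyRow h1) h2 :
      rel_hom (complex_rel K) (complex_rel K) r (fun s => s :|: rs s).
    move=> u s /andP[sK us]; rewrite /complex_rel sub_rs // inE.
    by rewrite (imset_f r us) orbT.
  apply: RelHtpyCol h2 _ => u s /andP[sK us]; rewrite /complex_rel.
  by rewrite (KS _ _ (sub_rs _ sK)) ?subsetUr //=; apply: imset_f.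
- set K' := deletion v K.
  pose h0 := @RelHtpyRefl _ _ _ _ (complex_rel K') (complex_rel K') id id.
  have /(RelHtpyCol h0) h1 : rel_hom (complex_rel K') (complex_rel K') id rs.
    by move=> u s /andP[sK us]; rewrite /complex_rel rsV ?sK //; move: sK; rewrite inE => /andP[].
  apply: RelHtpyRow h1 _ => u s /andP[sK us]; move: (sK); rewrite inE => /andP[_ vs].
  by rewrite /= /complex_rel /= (rsV _ vs) sK /= /r ifN //; apply: contra vs => /eqP <-.
Qed.

(** The column [y] stands for the facet [W :\ y], which makes the relation visibly symmetric. *)
Definition boundary_rel (W : {set T}) (x y : T) : bool :=
  [&& x \in W, y \in W & x != y].

Lemma boundary_rel_minimal (W : {set T}) : rel_minimal (boundary_rel W).
Proof.
split.
- move=> x z y xy H; apply/eqP/negPn/negP => zx.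
  have /and3P[zW _ _] := H _ xy; have /and3P[xW _ _] := xy.
  by have := H z; rewrite /boundary_rel xW zW eqxx eq_sym zx => /(_ isT).
- move=> x y z zx H; apply/eqP/negPn/negP => yx.
  have /and3P[_ yW _] := H _ zx; have /and3P[_ xW _] := zx.
  by have := H y; rewrite /boundary_rel xW yW eqxx yx => /(_ isT).
Qed.

End ComplexRelations.

Section NerveRelations.
Variable T : finType.
Implicit Types (K L X Y : {set {set T}}) (s t F : {set T}) (v w : T).

(** A simplex of the nerve goes to a point common to its facets, and a point goes to the set of all
    facets through it. The point [x0] only fills in for sets of facets where no common point is
    found. *)
Lemma nerve_complex_rel K (x0 : T) :
  rel_equiv (complex_rel (nerve K)) (rel_tr (facet_rel K)).
Proof.
pose g (A : {set {set T}}) := odflt x0 [pick v in \bigcap_(s in A) s].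
pose g' v := [set F in facets K | v \in F].
apply: (@rel_equiv_cols _ _ _ _ _ g g').
- move=> F A /andP[]; rewrite inE => /andP[AK AI] FA.
  rewrite /rel_tr /facet_rel (subsetP AK) //= /g.
  case: pickP => [v /bigcapP|H]; first exact.
  move: AI; have /negbTE-> : A != set0 by apply/set0Pn; exists F.
  by move=> /set0Pn[v]; rewrite H.
- move=> F v; rewrite /rel_tr /complex_rel !inE.
  rewrite /facet_rel => /andP[FK vF]; move: (FK); rewrite inE vF => -> /=.
  rewrite andbT; apply/andP; split; first by apply/subsetP => G; rewrite inE => /andP[].
  apply/orP; right; apply/set0Pn; exists v; apply/bigcapP => G.
  by rewrite inE => /andP[].
Qed.

(** A proper face goes to some vertex [y] that it misses, and so lies in the facet [W :\ y]. *)
Lemma boundary_complex_rel (W : {set T}) (x0 : T) :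
  rel_equiv (complex_rel (boundary W)) (boundary_rel W).
Proof.
pose g s := odflt x0 [pick y in W :\: s].
apply: (@rel_equiv_cols _ _ _ _ _ g (fun y => W :\ y)).
- move=> x s /andP[]; rewrite inE => /properP[sW [y yW ys]] xs.
  rewrite /boundary_rel (subsetP sW) //= /g.
  case: pickP => [z|/(_ y)]; rewrite inE ?yW ?ys //= => /andP[zs ->] /=.
  by apply: contra zs => /eqP <-.
- move=> x y /and3P[xW yW xy]; rewrite /complex_rel !inE xW xy !andbT.
  by rewrite properD1.
Qed.

(** If [w] lies on every facet through [v], then adding [w] to a simplex through [v] stays inside a
    facet, so [w] dominates [v]. For columns, a facet contained in another equals it by
    maximality. *)
Lemma undominated_facet_rel_minimal K : simplicial_complex K ->
  (forall v w, v \in vertices K -> ~~ vertex_dominated K v w) ->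
  rel_minimal (facet_rel K).
Proof.
move=> cK undom; have /complexP[K0 KS] := cK; split.
- move=> v w F /andP[/facetsP[FK F0 Fmax] vF] H.
  have vK := mem_vertices cK FK vF.
  apply/eqP/negPn/negP; rewrite eq_sym => vw.
  have /negP := undom v w vK; apply; apply/vertex_dominatedP => //; split=> //.
  move=> s sK vs; have s0 : s != set0 by apply/set0Pn; exists v.
  have [G GK sG] := facet_exists sK s0.
  have /andP[_ wG] : facet_rel K w G by apply: H; rewrite /facet_rel GK (subsetP sG).
  have /facetsP[G1 _ _] := GK.
  by apply: KS G1 _; rewrite subUset sub1set wG.
- move=> F G v vF H; have /andP[FK _] := vF.
  have /andP[GK _] := H _ vF.
  have [/facetsP[_ _ Fmax] /facetsP[GK1 _ _]] := (FK, GK).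
  by apply: Fmax => //; apply/subsetP => w wF; have /andP[] := H w (introT andP (conj FK wF)).
Qed.

(** Both relations are rigid, so homotopy inverses are true inverses on incident points and the
    relations are isomorphic. Every facet is then the vertex set minus one vertex, and each vertex
    is the one omitted by some facet. *)
Lemma facet_rel_boundary K (U : finType) (W : {set U}) :
  simplicial_complex K -> rel_minimal (facet_rel K) -> 1 < #|W| ->
  rel_equiv (facet_rel K) (boundary_rel W) ->
  K = boundary (vertices K) /\ #|vertices K| = #|W|.
Proof.
move=> cK Kmin W1 [h [g [p [q [hg pq ph hp]]]]].
have /complexP[K0 KS] := cK.
set X := vertices K.
have {}ph v F : facet_rel K v F -> p (h v) = v /\ q (g F) = F.
  exact: (rel_minimal_rigid Kmin ph).
have {}hp x y : boundary_rel W x y -> h (p x) = x /\ g (q y) = y.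
  exact: (rel_minimal_rigid (@boundary_rel_minimal _ W) hp).
(* This is where [1 < #|W|] enters: every point of [W] has an incidence, so rigidity applies to all
   of [W]. *)
have other x : exists2 y, y \in W & y != x.
  have : 0 < #|W :\ x| by have := cardsD1 x W; case: (x \in W) => /= E; lia.
  by rewrite card_gt0 => /set0Pn[y]; rewrite !inE => /andP[yx yW]; exists y.
have Xfacet v : v \in X -> exists F, facet_rel K v F.
  rewrite inE => vK; have v0 : [set v] != set0 by apply/set0Pn; exists v; rewrite inE.
  by have [F FK] := facet_exists vK v0; rewrite sub1set; exists F; rewrite /facet_rel FK.
have facetX v F : facet_rel K v F -> v \in X.
  by move=> /andP[/facetsP[FK _ _]]; apply: mem_vertices.
have ph1 v : v \in X -> p (h v) = v by move=> /Xfacet[F /ph[]].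
have hW v : v \in X -> h v \in W by move=> /Xfacet[F /hg/and3P[]].
have hp1 x : x \in W -> h (p x) = x.
  move=> xW; have [y yW yx] := other x.
  by have [] := hp x y _; rewrite // /boundary_rel xW yW eq_sym.
have qF y : y \in W -> q y \in facets K /\ g (q y) = y.
  move=> yW; have [x xW xy] := other y.
  have B : boundary_rel W x y by rewrite /boundary_rel xW yW.
  by have [_ ->] := hp _ _ B; have /andP[] := pq _ _ B.
have pX x : x \in W -> p x \in X.
  move=> xW; have [y yW yx] := other x.
  by apply: (facetX _ (q y)); apply: pq; rewrite /boundary_rel xW yW eq_sym.
have gW F : F \in facets K -> g F \in W.
  move=> FK; have /facetsP[_ /set0Pn[v vF] _] := FK.
  by have /hg/and3P[] : facet_rel K v F by rewrite /facet_rel FK.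
have qg F : F \in facets K -> q (g F) = F.
  move=> FK; have /facetsP[_ /set0Pn[v vF] _] := FK.
  by have /ph[] : facet_rel K v F by rewrite /facet_rel FK.
have facetE F : F \in facets K -> F = X :\ p (g F).
  move=> FK; apply/setP => v; rewrite in_setD1; apply/idP/andP.
    move=> vF; have vF' : facet_rel K v F by rewrite /facet_rel FK.
    split; last exact: facetX vF'.
    apply/eqP => vE; have /and3P[_ _] := hg _ _ vF'.
    by rewrite vE hp1 ?gW // eqxx.
  move=> [vF vX]; have : boundary_rel W (h v) (g F).
    rewrite /boundary_rel hW // gW //=; apply: contra vF => /eqP <-.
    by rewrite ph1.
  by move=> /pq/andP[_]; rewrite ph1 // qg.
split.
  apply/setP => s; rewrite inE; apply/idP/idP.
    move=> sK; case: (eqVneq s set0) => [->|s0].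
      (* The argument of [other] is an arbitrary point; only some [y] in [W] is wanted, so that
         [p y] shows [X] to be nonempty. *)
      have [y yW _] := other (h (p (enum_val (Ordinal (ltnW W1))))).
      by rewrite proper0; apply/set0Pn; exists (p y); apply: pX.
    have [F FK sF] := facet_exists sK s0.
    apply: (sub_proper_trans sF); rewrite (facetE _ FK) properD1 //.
    exact/pX/gW.
  move=> /properP[sX [x xX xs]].
  have [FK gq] := qF (h x) (hW _ xX).
  have /facetsP[F1 _ _] := FK.
  apply: KS F1 _; rewrite (facetE _ FK) gq ph1 //.
  by apply/subsetP => v vs; rewrite in_setD1 (subsetP sX) // andbT; apply: contra xs => /eqP <-.
have -> : W = h @: X.
  apply/setP => x; apply/idP/imsetP => [xW|[v vX ->]]; last exact: hW.
  by exists (p x); rewrite ?hp1 ?pX.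
by rewrite card_in_imset // => v w vX wX /(congr1 p); rewrite !ph1.
Qed.

(** A strong collapse is read from its end: properties pass from [L] back to [K] one deletion at a
    time, every intermediate family being known to be a complex. *)
Lemma strong_collapse_rev_ind L (P : {set {set T}} -> Prop) :
  (simplicial_complex L -> P L) ->
  (forall K v w, simplicial_complex K -> v \in vertices K ->
     vertex_dominated K v w -> strong_collapse (deletion v K) L ->
     P (deletion v K) -> P K) ->
  forall K, simplicial_complex K -> strong_collapse K L -> P K.
Proof.
move=> PL Pstep K cK /connectP[p]; elim: p K cK => [|K1 p IH] K cK /=.
  by move=> _ /= LK; rewrite LK in PL; apply: PL.
move=> /andP[/existsP[v /andP[vK /andP[/existsP[w dom] /eqP K1E]]] pth] LE.
rewrite {K1}K1E in pth LE.
have sL : strong_collapse (deletion v K) L by apply/connectP; exists p.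
apply: (Pstep K v w) => //.
by apply: IH => //; apply: deletion_complex.
Qed.

Lemma strong_collapse_complex K L :
  simplicial_complex K -> strong_collapse K L -> simplicial_complex L.
Proof. by apply: strong_collapse_rev_ind. Qed.

Lemma strong_collapse_sub K L :
  simplicial_complex K -> strong_collapse K L -> L \subset K.
Proof.
apply: (strong_collapse_rev_ind (P := fun K => L \subset K)) => //.
move=> {}K v w _ _ _ _ /subset_trans; apply.
by apply/subsetP => s; rewrite inE => /andP[].
Qed.

Lemma strong_collapse_rel_equiv K L : simplicial_complex K ->
  strong_collapse K L -> rel_equiv (complex_rel K) (complex_rel L).
Proof.
apply: (strong_collapse_rev_ind
  (P := fun K => rel_equiv (complex_rel K) (complex_rel L))) => [_|{}K v w cK vK dom _].
  exact: (@rel_equiv_cols _ _ _ _ _ id id).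
exact/rel_equiv_trans/(deletion_complex_rel cK vK dom).
Qed.

(** The dominating vertex survives the deletion, so a strong collapse never removes the last
    vertex. *)
Lemma strong_collapse_vertices K L : simplicial_complex K ->
  strong_collapse K L -> vertices L = set0 -> vertices K = set0.
Proof.
apply: (strong_collapse_rev_ind
  (P := fun K => vertices L = set0 -> vertices K = set0)) => [//|K' v w cK vK dom _ IH L0].
have [vw domw] := vertex_dominatedP w cK vK dom.
have /complexP[K0 KS] := cK.
have /setP/(_ w) := IH L0; rewrite !inE => /negbT/negP[].
rewrite inE in vK; rewrite vw andbT; apply: KS (domw _ vK _) _; rewrite ?inE //.
by rewrite subsetUl.
Qed.

(** Deleting a dominated vertex [v] loses at least the simplex [[set v]], so repeating this
    terminates. *)
Lemma strong_core K : simplicial_complex K ->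
  exists2 L, strong_collapse K L &
    forall v w, v \in vertices L -> ~~ vertex_dominated L v w.
Proof.
have [n] := ubnP #|K|; elim: n K => [//|n IH] K Kn cK.
case: (boolP [forall v in vertices K, forall w, ~~ vertex_dominated K v w]).
  move=> /forall_inP H; exists K => [|v w vK]; first exact: connect0.
  by have /forallP := H _ vK.
rewrite negb_forall_in => /exists_inP[v vK]; rewrite negb_forall => /existsP[w].
rewrite negbK => dom.
have ltK : #|deletion v K| < n.
  suff /proper_card KK : deletion v K \proper K by apply: leq_trans KK _; rewrite -ltnS.
  apply/properP; split; first by apply/subsetP => s; rewrite inE => /andP[].
  by move: vK; rewrite inE => vK; exists [set v]; rewrite // inE set11 andbF.
have [L KL undom] := IH (deletion v K) ltK (deletion_complex v cK).
exists L => //; apply: connect_trans KL; apply: connect1.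
by apply/exists_inP; exists v => //; rewrite eqxx andbT; apply/existsP; exists w.
Qed.

Lemma nerve_vertices0 K : simplicial_complex K ->
  vertices (nerve K) = set0 -> K = [set set0].
Proof.
move=> cK N0; have /complexP[K0 KS] := cK; apply/setP => s; rewrite inE.
apply/idP/eqP => [sK|->//]; apply/eqP/negPn/negP => s0.
have [F FK sF] := facet_exists sK s0.
have : F \in vertices (nerve K).
  rewrite !inE sub1set FK big_set1.
  by have /facetsP[_ -> _] := FK; rewrite orbT.
by rewrite N0 inE.
Qed.

End NerveRelations.

(** * Complexes isomorphic to the boundary of a simplex *)

Lemma vertices_boundary (S : finType) (s : {set S}) :
  vertices (boundary s) = if 1 < #|s| then s else set0.
Proof.
(* A set with at most one point has no proper one-point subset, so its boundary has no vertices. *)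
apply/setP => v; rewrite !inE properEcard sub1set cards1.
by case: ifP => _; rewrite ?inE ?andbT ?andbF.
Qed.

Lemma mem_boundary (S : finType) (s t : {set S}) :
  t \subset vertices (boundary s) -> (t \in boundary s) = (#|t| < #|s|).
Proof.
rewrite vertices_boundary inE properEcard => ts.
suff -> : t \subset s by [].
by apply: subset_trans ts _; case: ifP => // _; apply: sub0set.
Qed.

(** Membership depends on cardinality alone, so any bijection of the vertices is an isomorphism; one
    is obtained by enumerating both sides. *)
Lemma isomorphic_by_card (T U : finType) (K : {set {set T}})
    (L : {set {set U}}) (m : nat) :
  #|vertices K| = #|vertices L| ->
  (forall s : {set T}, s \subset vertices K -> (s \in K) = (#|s| < m)) ->
  (forall s : {set U}, s \subset vertices L -> (s \in L) = (#|s| < m)) ->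
  isomorphic K L.
Proof.
move=> KL HK HL.
have E : #|{: {x | x \in vertices K}}| = #|{: {y | y \in vertices L}}|.
  by rewrite !card_sig; exact: KL.
exists (fun x => enum_val (cast_ord E (enum_rank x))); split.
  exists (fun y => enum_val (cast_ord (esym E) (enum_rank y))) => x.
    by rewrite enum_valK cast_ordK enum_rankK.
  by rewrite enum_valK cast_ordKV enum_rankK.
move=> s; rewrite HK ?HL.
- rewrite (card_imset _ val_inj) card_imset //.
  by move=> x y /val_inj/enum_val_inj/cast_ord_inj/enum_rank_inj.
- by apply/subsetP => _ /imsetP[x _ ->]; apply: valP.
- by apply/subsetP => _ /imsetP[x _ ->]; apply: valP.
Qed.

Lemma isomorphic_boundary_card (T S : finType) (K : {set {set T}})
    (s : {set S}) :
  isomorphic K (boundary s) ->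
  #|vertices K| = #|vertices (boundary s)| /\
  forall t : {set T}, t \subset vertices K -> (t \in K) = (#|t| < #|s|).
Proof.
move=> [f [bf fK]]; split.
  by rewrite -[LHS]card_sig -[RHS]card_sig; apply: bij_eq_card bf.
move=> t tK; pose t' := [set x : {x | x \in vertices K} | val x \in t].
have -> : t = [set val x | x in t'].
  apply/setP => x; apply/idP/imsetP => [xt|[y]]; last by rewrite inE => ? ->.
  by exists (Sub x (subsetP tK x xt)); rewrite ?inE ?SubK.
rewrite fK mem_boundary.
  rewrite (card_imset _ val_inj) card_imset //.
  by move=> x y /val_inj /(bij_inj bf).
by apply/subsetP => _ /imsetP[x _ ->]; apply: valP.
Qed.

(** The case [#|sigma| = 1] is separate because the boundary is then the sphere of dimension -1,
    without vertices, and the argument with relations has no incidences to work on. *)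
Lemma strong_collapse_boundary (T S : finType) (K : {set {set T}})
    (sigma : {set S}) :
  simplicial_complex K -> strong_collapses_to (nerve K) (boundary sigma) ->
  K = [set set0] /\ #|sigma| = 1 \/
  exists X : {set T},
    [/\ strong_collapse K (boundary X), 1 < #|X| & #|X| = #|sigma|].
Proof.
move=> cK [N NN isoN]; have cN := nerve_complex K.
have cN' := strong_collapse_complex cN NN.
have /complexP[N0 _] := cN'.
have [cardN memN] := isomorphic_boundary_card isoN.
(* The empty simplex belongs to [N], so [sigma] is nonempty. *)
have := memN set0 (sub0set _); rewrite N0 cards0 => /esym s0.
rewrite vertices_boundary in cardN.
case: ifP cardN => [s1 cardN|s1 /eqP]; last first.
  rewrite cards0 cards_eq0 => /eqP V0; left; split; last by lia.
  exact/(nerve_vertices0 cK)/(strong_collapse_vertices cN NN).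
right; have [L KL undom] := strong_core cK.
have cL := strong_collapse_complex cK KL.
have NE : N = boundary (vertices N).
  apply/setP => A; rewrite inE properEcard cardN.
  case: (boolP (A \subset vertices N)) => [/memN //|/subsetPn[F FA FN]] /=.
  by apply/negP => AN; case/negP: FN; apply: mem_vertices AN FA.
have [x0 _] : exists x0 : T, true.
  have : vertices N != set0 by rewrite -card_gt0 cardN; lia.
  move=> /set0Pn[F]; rewrite inE => /(subsetP (strong_collapse_sub cN NN)).
  rewrite inE sub1set => /andP[/facetsP[_ /set0Pn[x _] _] _].
  by exists x.
(* The chain runs from the core [L] to [K], then through the transpose to the nerve and to its
   collapse [N]; the symmetry of [boundary_rel] undoes the transposition. *)
have eqL : rel_equiv (facet_rel L) (boundary_rel (vertices N)).
  apply: rel_equiv_trans (rel_equiv_sym (complex_rel_facet_rel L)) _.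
  apply: rel_equiv_trans (rel_equiv_sym (strong_collapse_rel_equiv cK KL)) _.
  apply: rel_equiv_trans (complex_rel_facet_rel K) _.
  apply: (@rel_equiv_trans _ _ _ _ _ _ _ (rel_tr (boundary_rel (vertices N)))).
    apply: rel_equiv_tr (rel_equiv_trans (rel_equiv_sym (nerve_complex_rel K x0)) _).
    apply: rel_equiv_trans (strong_collapse_rel_equiv cN NN) _.
    by rewrite {1}NE; apply: boundary_complex_rel set0.
  have hB : rel_hom (rel_tr (boundary_rel (vertices N))) (boundary_rel (vertices N)) id id.
    by move=> x y /and3P[xW yW xy]; rewrite /boundary_rel xW yW eq_sym.
  apply: (@rel_equiv_cols _ _ _ _ _ id id) => //.
  by move=> x y /and3P[xW yW xy]; rewrite /rel_tr /boundary_rel xW yW eq_sym.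
have [|LE cardL] := facet_rel_boundary cL (undominated_facet_rel_minimal cL undom) _ eqL.
  by rewrite cardN.
by exists (vertices L); rewrite -LE cardL cardN.
Qed.

(** * Relative cones and Alexander duals *)

(** If [X] is closed under subsets, [w |: s] is outside [X] whenever [s] is, so [Y :\: X] splits
    into pairs of a set without [w] and the same set with [w] added. *)
Definition relative_cone (T : finType) (w : T) (X Y : {set {set T}}) : Prop :=
  X \subset Y /\
  forall s, s \in Y :\: X -> w |: s \in Y /\ s :\ w \in Y :\: X.

Section RelativeCones.
Variable T : finType.
Implicit Types (K L X Y : {set {set T}}) (s t F V : {set T}) (v w : T).

(** Among the simplices of [Y :\: X] without [w], a largest one [s] is a free face of [w |: s].
    Removing this pair leaves a smaller relative cone over [X]. *)
Lemma relative_cone_collapse w X Y : simplicial_complex X ->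
  relative_cone w X Y -> simplicial_collapse Y X.
Proof.
move=> /complexP[X0 XS].
have [n] := ubnP #|Y|; elim: n Y => [//|n IH] Y Yn [XY Ycone].
have [->|YX] := eqVneq Y X; first exact: connect0.
have [s0 s0YX] : exists s, s \in Y :\: X.
  by apply/set0Pn; rewrite setD_eq0; apply: contra YX => YX; rewrite eqEsubset YX.
pose P s := (s \in Y :\: X) && (w \notin s).
have P0 : P (s0 :\ w) by rewrite /P setD11; have [_ ->] := Ycone _ s0YX.
have [s /andP[sYX ws] smax] := @arg_maxnP _ _ P (fun s => #|s|) P0.
(* A proper coface [r] is also outside [X], so [r :\ w] competes with [s]; it contains [s], hence
   equals it. *)
have {smax} free r : r \in Y -> s \proper r -> r = w |: s.
  move=> rY sr; have [_ rYX] : w |: r \in Y /\ r :\ w \in Y :\: X.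
    apply: Ycone; rewrite inE rY andbT; move: sYX; rewrite inE => /andP[+ _].
    by apply: contra => rX; apply: XS rX (proper_sub sr).
  have srw : s \subset r :\ w.
    rewrite subsetD1 (proper_sub sr) ws //.
  have /smax : P (r :\ w) by rewrite /P rYX setD11.
  move=> rs; have /eqP sE : s == r :\ w by rewrite eqEcard srw.
  case: (boolP (w \in r)) => wr; first by rewrite sE setD1K.
  by move: sr; rewrite sE (setDidPl _) ?properxx // disjoint_sym disjoints1.
have [wsY _] := Ycone _ sYX.
move: (sYX); rewrite inE => /andP[sX sY].
have wsX : w |: s \notin X.
  by apply: contra sX => /XS; apply; apply: subsetUr.
pose Y' := Y :\: [set s; w |: s].
have s0' : s != set0 by apply: contraNneq sX => ->.
have YY' : elementary_collapse Y Y'.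
  apply/existsP; exists s; apply/existsP; exists (w |: s).
  rewrite s0' eqxx andbT; apply/and5P; split=> //.
  - by apply: properUr; rewrite sub1set.
  - rewrite cardsU1 ws eqxx /=.
    by apply/forall_inP => r rY; apply/implyP => /(free r rY)->.
apply: connect_trans (connect1 YY') _; apply: IH.
  suff /proper_card YY : Y' \proper Y by apply: leq_trans YY _; rewrite -ltnS.
  by apply/properP; split; [exact: subsetDl|exists s; rewrite // !inE eqxx].
split.
  apply/subsetP => r rX; rewrite !inE (subsetP XY) // andbT negb_or.
  by apply/andP; split; [move: sX|move: wsX]; apply: contraNneq => <-.
(* The removed pair is closed under adding and deleting [w], so a remaining simplex is never sent
   into it. *)
move=> r; rewrite in_setD => /andP[rX].
rewrite in_setD in_set2 negb_or => /andP[/andP[rs rws] rY].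
have [wrY rwYX] : w |: r \in Y /\ r :\ w \in Y :\: X.
  by apply: Ycone; rewrite inE rX.
move: rwYX; rewrite inE => /andP[rwX rwY].
have ws_r : (w |: r != s) && (w |: r != w |: s).
  apply/andP; split; first by apply: contraNneq ws => <-; rewrite setU11.
  apply/eqP => E; case: (boolP (w \in r)) => wr.
    by case/eqP: rws; rewrite -E; apply/esym/setUidPr; rewrite sub1set.
  by case/eqP: rs; rewrite -(setU1K wr) E setU1K.
split; first by rewrite in_setD in_set2 negb_or ws_r wrY.
rewrite in_setD rwX in_setD in_set2 negb_or rwY andbT /=; apply/andP; split.
  apply/eqP => E; case: (boolP (w \in r)) => wr.
    by case/eqP: rws; rewrite -E setD1K.
  by case/eqP: rs; rewrite -E (setDidPl _) // disjoint_sym disjoints1.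
by apply/eqP => /setP/(_ w); rewrite !inE eqxx.
Qed.

(** The lost simplices are those through [v]; since [w] differs from [v], adding or removing [w]
    keeps [v], and domination keeps the enlarged set in [K]. *)
Lemma dominated_relative_cone K v w : simplicial_complex K ->
  v \in vertices K -> vertex_dominated K v w ->
  relative_cone w (deletion v K) K.
Proof.
move=> cK vK /(vertex_dominatedP w cK vK)[vw dom]; have /complexP[_ KS] := cK.
split=> [|s]; first by apply/subsetP => s; rewrite inE => /andP[].
rewrite !inE => /andP[+ sK]; rewrite sK /= negbK => vs; split; first exact: dom.
have sw : s :\ w \in K by apply: KS sK _; apply: subD1set.
by rewrite sw /= negbK vw vs.
Qed.

Lemma strong_collapse_simplicial K L : simplicial_complex K ->
  strong_collapse K L -> simplicial_collapse K L.
Proof.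
apply: (strong_collapse_rev_ind (P := fun K => simplicial_collapse K L)).
  by move=> _; apply: connect0.
move=> K' v w cK vK dom _; apply: connect_trans.
apply: relative_cone_collapse (dominated_relative_cone cK vK dom).
exact: deletion_complex.
Qed.

(** * Relative cones between Alexander duals *)

Lemma alexander_dual_closed V K s t : simplicial_complex K ->
  s \in alexander_dual V K -> t \subset s -> t \in alexander_dual V K.
Proof.
move=> /complexP[_ KS]; rewrite !inE => /andP[sV sK] ts.
rewrite (subset_trans ts sV); apply: contra sK => /KS; apply.
exact: setDS.
Qed.

Lemma alexander_dual_complex V K : simplicial_complex K -> V \notin K ->
  simplicial_complex (alexander_dual V K).
Proof.
move=> cK VK; apply/complexP; split; first by rewrite inE sub0set setD0 VK.
by move=> s t; apply: alexander_dual_closed.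
Qed.

(** The simplices gained by the dual have complements in [K] that contain [v]. Adding [w] to [s]
    leaves [v] in the complement; removing [w] from [s] adds [w] to the complement, which stays in
    [K] by domination. *)
Lemma alexander_dual_relative_cone V K v w : simplicial_complex K ->
  vertices K \subset V -> v \in vertices K -> vertex_dominated K v w ->
  relative_cone w (alexander_dual V K) (alexander_dual V (deletion v K)).
Proof.
move=> cK KV vK /(vertex_dominatedP w cK vK)[vw dom]; have /complexP[_ KS] := cK.
have wV : w \in V.
  have vK1 : [set v] \in K by move: vK; rewrite inE.
  by apply: (subsetP KV); apply: mem_vertices cK (dom _ vK1 (set11 v)) (setU11 _ _).
have dualE L s : (s \in alexander_dual V L) = (s \subset V) && (V :\: s \notin L).
  by rewrite inE.
have delE s : (s \in deletion v K) = (s \in K) && (v \notin s) by rewrite inE.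
split.
  apply/subsetP => s; rewrite !dualE => /andP[-> /=]; apply: contra.
  by rewrite delE => /andP[].
move=> s; rewrite in_setD !dualE delE => /andP[+ /andP[sV]].
rewrite sV /= negbK => sK; rewrite sK /= negbK => vs.
rewrite in_setD !dualE !delE subUset sub1set wV sV /=.
rewrite (subset_trans (subD1set _ _) sV) /= negbK.
have -> : V :\: (s :\ w) = w |: (V :\: s).
  by apply/setP => u; rewrite !inE; case: eqVneq => //= ->.
rewrite (dom _ sK vs) /= !negbK !inE (negbTE vw) /=; move: vs; rewrite inE.
by move=> /andP[-> ->]; rewrite !andbT /= andbF.
Qed.

(** A simplex of the dual outside the smaller boundary misses some [u] of [V :\: X]. As [w] is in
    [X], it differs from [u], so adding or removing [w] still misses [u]. *)
Lemma boundary_dual_relative_cone (V X : {set T}) w : X \subset V -> w \in X ->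
  relative_cone w (boundary (w |: V :\: X)) (alexander_dual V (boundary X)).
Proof.
move=> XV wX; have wV : w \in V := subsetP XV _ wX.
have dualE s : (s \in alexander_dual V (boundary X)) =
    (s \subset V) && ((s == V :\: X) || ~~ (V :\: X \subset s)).
  rewrite !inE properEneq negb_and negbK; case: (boolP (s \subset V)) => //= sV.
  congr (_ || _).
    apply/eqP/eqP => [<-|->]; first by rewrite setDDr setDv set0U; apply/esym/setIidPr.
    by rewrite setDDr setDv set0U; apply/setIidPr.
  congr (~~ _); apply/subsetP/subsetP => H u.
    rewrite inE => /andP[uX uV]; apply: contraR uX => us; apply: H.
    by rewrite inE us.
  rewrite inE => /andP[us uV]; apply: contraR us => uX; apply: H.
  by rewrite inE uX.
have sVX s : s \in alexander_dual V (boundary X) :\: boundary (w |: V :\: X) ->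
    s \subset V /\ exists2 u, u \in V :\: X & u \notin s.
  rewrite in_setD dualE => /and3P[sB -> /orP[/eqP sE|/subsetPn//]]; split=> //.
  case/negP: sB; rewrite sE inE properEcard subsetUr cardsU1 !inE wX.
  by rewrite ltnSn.
split.
  apply/subsetP => s; rewrite inE dualE => sp.
  have -> /= : s \subset V.
    apply: subset_trans (proper_sub sp) _.
    by rewrite subUset sub1set wV subsetDl.
  case: (boolP (V :\: X \subset s)) => [VXs|]; last by rewrite orbT.
  rewrite orbF eq_sym eqEcard VXs /=.
  by have := proper_card sp; rewrite cardsU1 !inE wX /= add1n ltnS.
move=> s sB; have [sV [u uVX us]] := sVX s sB; split.
  rewrite dualE subUset sub1set wV sV /=; apply/orP; right.
  apply/subsetPn; exists u => //; rewrite !inE negb_or us andbT.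
  by apply: contraTneq uVX => ->; rewrite inE wX.
rewrite in_setD dualE (subset_trans (subD1set _ _) sV) /=; apply/andP; split.
  move: sB; rewrite in_setD => /andP[+ _]; rewrite !inE.
  apply: contra => /proper_sub sw; apply/properP; split.
    apply/subsetP => x xs; have [->|xw] := eqVneq x w; first by rewrite setU11.
    by apply: (subsetP sw); rewrite !inE xw.
  by exists u => //; rewrite in_setU uVX orbT.
apply/orP; right; apply/subsetPn; exists u => //.
by rewrite inE negb_and us orbT.
Qed.

End RelativeCones.

Lemma boundary_complex (T : finType) (W : {set T}) :
  W != set0 -> simplicial_complex (boundary W).
Proof.
move=> W0; apply/complexP; split; first by rewrite inE proper0.
by move=> s t; rewrite !inE => sW ts; apply: sub_proper_trans ts sW.
Qed.

Lemma boundary_isomorphic (T S : finType) (X : {set T}) (sigma : {set S}) :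
  #|X| = #|sigma| -> isomorphic (boundary X) (boundary sigma).
Proof.
move=> XS; apply: (@isomorphic_by_card _ _ _ _ #|X|).
- by rewrite !vertices_boundary XS; case: ifP => // _; rewrite !cards0.
- exact: mem_boundary.
- by rewrite XS; apply: mem_boundary.
Qed.

Lemma set0_isomorphic_boundary (T S : finType) (sigma : {set S}) :
  #|sigma| = 1 -> isomorphic [set set0 : {set T}] (boundary sigma).
Proof.
move=> s1; apply: (@isomorphic_by_card _ _ _ _ 1).
- rewrite vertices_boundary s1 cards0; apply/eqP; rewrite cards_eq0.
  apply/eqP/setP => v; rewrite !inE; apply/eqP => /setP/(_ v).
  by rewrite !inE eqxx.
- by move=> s _; rewrite inE ltnS leqn0 cards_eq0.
- by move=> s ssub; rewrite mem_boundary // s1.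
Qed.

Lemma alexander_dual_set0 (T : finType) (V : {set T}) :
  alexander_dual V [set set0] = boundary V.
Proof. by apply/setP => s; rewrite !inE properE setD_eq0. Qed.

(** Not being a full simplex passes back along strong collapses; it guarantees that the duals
    contain the empty simplex. *)
Lemma deletion_vertices_notin (T : finType) (K : {set {set T}}) (v : T) :
  simplicial_complex K -> vertices (deletion v K) \notin deletion v K ->
  vertices K \notin K.
Proof.
move=> /complexP[_ KS]; apply: contra => VK; rewrite !inE eqxx andbF andbT.
by apply: KS VK _; apply/subsetP => u; rewrite !inE => /andP[].
Qed.

From mathcomp Require Import all_classical all_reals all_analysis lra.
Import Order.TTheory GRing.Theory Num.Theory.
Import numFieldNormedType.Exports.

Local Open Scope ring_scope.
Local Open Scope classical_set_scope.

(** * Homotopy equivalences *)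

Section Homotopy.
Variable R : realType.

Definition clamp (t : R) : R := Num.min (Num.max 0 t) 1.

Lemma clamp_itv t : 0 <= clamp t <= 1.
Proof. by rewrite le_min le_max lexx ler01 ge_min lexx orbT. Qed.

Lemma clampK t : 0 <= t <= 1 -> clamp t = t.
Proof. by move=> /andP[t0 t1]; rewrite /clamp max_r // min_l. Qed.

Lemma clamp_continuous : continuous clamp.
Proof.
apply: min_fun_continuous; last by move=> ?; apply: cvg_cst.
by apply: max_fun_continuous => ?; [apply: cvg_cst|apply: cvg_id].
Qed.

Lemma continuous_pair (Z X Y : topologicalType) (f : Z -> X) (g : Z -> Y) :
  continuous f -> continuous g -> continuous (fun z => (f z, g z)).
Proof. by move=> cf cg z; apply: cvg_pair; [apply: cf|apply: cg]. Qed.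

Lemma fst_continuous (X Y : topologicalType) : continuous (@fst X Y).
Proof. by move=> ?; apply: cvg_fst. Qed.

Lemma snd_continuous (X Y : topologicalType) : continuous (@snd X Y).
Proof. by move=> ?; apply: cvg_snd. Qed.

Lemma continuousT_comp (X Y Z : topologicalType) (f : X -> Y) (g : Y -> Z) :
  continuous f -> continuous g -> continuous (g \o f).
Proof. by move=> cf cg x; apply: continuous_comp; [apply: cf|apply: cg]. Qed.

Lemma id_continuous (X : topologicalType) : continuous (@id X).
Proof. by move=> ?; apply: cvg_id. Qed.

(** Clamping the time to the unit interval extends a homotopy continuously to all times, so that
    homotopies can be composed as globally continuous maps. *)
Lemma homotopicP (X Y : topologicalType) (f g : X -> Y) :
  homotopic R f g <->
  exists H : R * X -> Y,
    [/\ continuous H, forall x, H (0, x) = f x & forall x, H (1, x) = g x].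
Proof.
split=> [[H [cH H0 H1]]|[H [cH H0 H1]]]; last first.
  by exists H; split=> //; apply: continuous_subspaceT.
exists (fun z => H (clamp z.1, z.2)); split=> [|x|x]; last 2 first.
- by rewrite /= clampK ?H0 // lexx ler01.
- by rewrite /= clampK ?H1 // lexx ler01.
move: cH => /subspace_sigL_continuousP cH.
have in01 (z : R * X) : (clamp z.1, z.2) \in `[0, 1] `*` [set: X].
  by apply/mem_set; split=> //=; rewrite in_itv /= clamp_itv.
pose A : set (R * X) := `[0, 1] `*` [set: X].
pose c z : set_type A := exist (fun x => x \in A) _ (in01 z).
suff : continuous c by move=> cc; apply: (continuousT_comp cc cH).
apply: continuous_comp_initial; apply: continuous_pair; last exact: snd_continuous.
exact: continuousT_comp (@fst_continuous _ _) clamp_continuous.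
Qed.

Lemma homotopic_postcomp (X Y Z : topologicalType) (f g : X -> Y) (h : Y -> Z) :
  continuous h -> homotopic R f g -> homotopic R (h \o f) (h \o g).
Proof.
move=> ch /homotopicP[H [cH H0 H1]]; apply/homotopicP; exists (h \o H).
by split=> [|x|x] /=; rewrite ?H0 ?H1 //; apply: continuousT_comp.
Qed.

Lemma homotopic_precomp (X Y Z : topologicalType) (f g : X -> Y) (h : Z -> X) :
  continuous h -> homotopic R f g -> homotopic R (f \o h) (g \o h).
Proof.
move=> ch /homotopicP[H [cH H0 H1]]; apply/homotopicP.
exists (fun z => H (z.1, h z.2)).
split=> [|x|x] /=; rewrite ?H0 ?H1 //.
apply: (@continuousT_comp _ _ _ (fun z => (z.1, h z.2))) cH.
apply: continuous_pair; first exact: fst_continuous.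
exact: continuousT_comp (@snd_continuous _ _) ch.
Qed.

Lemma homotopic_refl (X Y : topologicalType) (f : X -> Y) :
  continuous f -> homotopic R f f.
Proof.
move=> cf; apply/homotopicP; exists (f \o snd); split=> //.
exact: continuousT_comp (@snd_continuous _ _) cf.
Qed.

Lemma homotopic_trans (X Y : topologicalType) (f g h : X -> Y) :
  homotopic R f g -> homotopic R g h -> homotopic R f h.
Proof.
move=> /homotopicP[F [cF F0 F1]] /homotopicP[G [cG G0 G1]]; apply/homotopicP.
pose H (z : R * X) :=
  if z.1 <= 1 / 2 then F (2 * z.1, z.2) else G (2 * z.1 - 1, z.2).
exists H; split=> [|x|x]; rewrite /H /=; last 2 first.
- by rewrite ifT ?mulr0 ?F0 //; lra.
- by rewrite ifF; [rewrite -G1; congr (G (_, _)); lra|lra].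
have cF' : continuous (fun z : R * X => F (2 * z.1, z.2)).
  apply: (@continuousT_comp _ _ _ (fun z : R * X => (2 * z.1, z.2))) cF.
  apply: continuous_pair; last exact: snd_continuous.
  by move=> z; apply: cvgMl_tmp; apply: fst_continuous.
have cG' : continuous (fun z : R * X => G (2 * z.1 - 1, z.2)).
  apply: (@continuousT_comp _ _ _ (fun z : R * X => (2 * z.1 - 1, z.2))) cG.
  apply: continuous_pair; last exact: snd_continuous.
  move=> z; apply: cvgB; last exact: cvg_cst.
  by apply: cvgMl_tmp; apply: fst_continuous.
apply/continuous_subspace_setT.
have -> : [set: R * X] = [set z | z.1 <= 1 / 2] `|` [set z | 1 / 2 <= z.1].
  by apply/esym/seteqP; split=> // z _ /=; have [] := leP z.1 (1/2); [left|move=> /ltW; right].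
apply: withinU_continuous.
- by apply: (closed_comp _ (@closed_le _ _)) => z _; apply: fst_continuous.
- by apply: (closed_comp _ (@closed_ge _ _)) => z _; apply: fst_continuous.
- apply: (@subspace_eq_continuous _ _ _ (fun z : R * X => F (2 * z.1, z.2))).
    by move=> z /set_mem /= z1; rewrite /from_subspace ifT.
  exact: continuous_subspaceT.
(* The closed halves meet at time 1/2, where the definition of [H] selects [F]; there both formulas
   give [g]. *)
- apply: (@subspace_eq_continuous _ _ _ (fun z : R * X => G (2 * z.1 - 1, z.2))).
    move=> [t x] /set_mem /= t1; rewrite /from_subspace /=; case: ifP => // t2.
    have e1 : 2 * t = 1 by lra.
    by rewrite e1 subrr F1 G0.
  exact: continuous_subspaceT.
Qed.

Lemma homotopy_equivalent_sym (X Y : topologicalType) :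
  homotopy_equivalent R X Y -> homotopy_equivalent R Y X.
Proof. by move=> [f [g [cf cg gf fg]]]; exists g, f; split. Qed.

Lemma homotopy_equivalent_trans (X Y Z : topologicalType) :
  homotopy_equivalent R X Y -> homotopy_equivalent R Y Z ->
  homotopy_equivalent R X Z.
Proof.
move=> [f [g [cf cg gf fg]]] [p [q [cp cq qp pq]]].
exists (p \o f), (g \o q); split; try exact: continuousT_comp.
- apply: homotopic_trans gf.
  exact: (homotopic_postcomp cg (homotopic_precomp cf qp)).
- apply: homotopic_trans pq.
  exact: (homotopic_postcomp cp (homotopic_precomp cq fg)).
Qed.

Lemma homeomorphic_homotopy_equivalent (X Y : topologicalType)
    (f : X -> Y) (g : Y -> X) :
  continuous f -> continuous g -> cancel f g -> cancel g f ->
  homotopy_equivalent R X Y.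
Proof.
move=> cf cg fK gK; exists f, g; split=> //.
  have -> : g \o f = id by apply/funext => x /=; rewrite fK.
  by apply: homotopic_refl; apply: id_continuous.
have -> : f \o g = id by apply/funext => x /=; rewrite gK.
by apply: homotopic_refl; apply: id_continuous.
Qed.

End Homotopy.

(** * Continuity in barycentric coordinates *)

Section RealizationTopology.
Variables (R : realType) (T : finType) (K : {set {set T}}).

Definition bary (x : realization R K) : T -> R := \val x.

Definition realization_of (x : T -> R) (Kx : realization_set R K x) :
    realization R K :=
  exist (fun x : {ptws T -> R} => x \in realization_set R K) x (mem_set Kx).

Lemma baryP (x : realization R K) : realization_set R K (bary x).
Proof. exact: set_mem (valP x). Qed.

Lemma bary_inj : injective bary.
Proof. exact: val_inj. Qed.

Lemma bary_continuous v : continuous (fun x : realization R K => bary x v).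
Proof.
apply: (@continuousT_comp _ {ptws T -> R} _ bary (fun x => x v)).
  exact: initial_continuous.
exact: (@proj_continuous _ (fun=> R) v).
Qed.

Lemma realization_continuous (Z : topologicalType) (f : Z -> realization R K) :
  (forall v, continuous (fun z => bary (f z) v)) -> continuous f.
Proof.
move=> cf; apply: continuous_comp_initial => z.
apply/cvg_sup => v; move: z.
apply/(@continuousP _ (initial_topology (@^~ v))) => _ [B oB <-].
by have /continuousP/(_ B oB) := cf v.
Qed.

End RealizationTopology.

Section RealValuedContinuity.
Variables (R : realType) (Z : topologicalType).
Implicit Types f g : Z -> R.

Lemma continuousT_cst (c : R) : continuous (fun _ : Z => c).
Proof. by move=> z; apply: cvg_cst. Qed.

Lemma continuousT_add f g :
  continuous f -> continuous g -> continuous (fun z => f z + g z).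
Proof. by move=> cf cg z; apply: cvgD; [apply: cf|apply: cg]. Qed.

Lemma continuousT_sub f g :
  continuous f -> continuous g -> continuous (fun z => f z - g z).
Proof. by move=> cf cg z; apply: cvgB; [apply: cf|apply: cg]. Qed.

Lemma continuousT_mul f g :
  continuous f -> continuous g -> continuous (fun z => f z * g z).
Proof. by move=> cf cg z; apply: cvgM; [apply: cf|apply: cg]. Qed.

Lemma continuousT_inv f :
  (forall z, f z != 0) -> continuous f -> continuous (fun z => (f z)^-1).
Proof. by move=> f0 cf z; apply: cvgV => //; apply: cf. Qed.

Lemma continuousT_max f g :
  continuous f -> continuous g -> continuous (fun z => Num.max (f z) (g z)).
Proof. exact: max_fun_continuous. Qed.

Lemma continuousT_bigmin (I : finType) (P : pred I) (c : R) (F : I -> Z -> R) :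
  (forall i, P i -> continuous (F i)) ->
  continuous (fun z => \big[Num.min/c]_(i | P i) F i z).
Proof. by apply: continuous_big; apply: min_continuous. Qed.

Lemma continuousT_bigmax (I : finType) (P : pred I) (c : R) (F : I -> Z -> R) :
  (forall i, P i -> continuous (F i)) ->
  continuous (fun z => \big[Num.max/c]_(i | P i) F i z).
Proof. by apply: continuous_big; apply: max_continuous. Qed.

Lemma continuousT_sum (I : finType) (P : pred I) (F : I -> Z -> R) :
  (forall i, P i -> continuous (F i)) ->
  continuous (fun z => \sum_(i | P i) F i z).
Proof. by apply: continuous_big; apply: add_continuous. Qed.

End RealValuedContinuity.

(** * Realizations of relative cones *)

Section PushRetraction.
Variables (R : realType) (T : finType) (w : T) (X Y : {set {set T}}).
Hypotheses (cX : simplicial_complex X) (cY : simplicial_complex Y).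
Hypothesis XY : relative_cone w X Y.
Implicit Type x : T -> R.

Definition support x : {set T} := [set v | x v != 0]%SET.

(* Decrease all coordinates other than that of w at unit speed, giving the lost
   mass to w, until the support lies in X: depth is the stopping time and push
   the point reached.  The default value 1 of the minimum bounds every
   coordinate, so it never matters. *)
Definition depth x : R :=
  \big[Num.min/1]_(s in X) \big[Num.max/0]_(v | (v \notin s) && (v != w)) x v.

Definition trim x v : R := Num.max (x v - depth x) 0.

Definition push x v : R :=
  if v == w then 1 - \sum_(u | u != w) trim x u else trim x v.

Lemma depth_ge0 x : 0 <= depth x.
Proof.
apply: le_bigmin => // s _; elim/big_rec: _ => [//|v m _ m0].
by rewrite le_max m0 orbT.
Qed.

Lemma depth0 x : support x \in X -> depth x = 0.
Proof.
move=> xX; apply/eqP; rewrite eq_le depth_ge0 andbT.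
apply: (@bigmin_inf _ _ _ _ (support x)) => //; elim/big_rec: _ => [//|v m /andP[+ _] m0].
by rewrite inE negbK => /eqP ->; rewrite ge_max lexx.
Qed.

Lemma depth_witness x : (forall v, x v <= 1) ->
  exists2 s, s \in X & forall v, v \notin s -> v != w -> x v <= depth x.
Proof.
move=> x1; have /complexP[X0 _] := cX.
have /bigmin_leP : depth x <= depth x by [].
(* Either the depth is the default 1, which bounds all coordinates so that the empty simplex serves,
   or the minimum is attained at some [s]. *)
case=> [d1|[s sX ms]]; first by exists finset.set0 => // v _ _; apply: le_trans (x1 v) d1.
exists s => // v vs vw; apply: le_trans ms.
by apply: (@le_bigmax_cond _ _ _ _ v); rewrite vs vw.
Qed.

Lemma trim_ge0 x v : 0 <= trim x v.
Proof. by rewrite le_max lexx orbT. Qed.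

Lemma trim_le x v : 0 <= x v -> trim x v <= x v.
Proof. by move=> x0; rewrite ge_max x0 gerBl depth_ge0. Qed.

Lemma push_id x : realization_set R X x -> push x = x.
Proof.
move=> [x0 x1 xX]; have d0 := depth0 xX.
have trimE v : trim x v = x v by rewrite /trim d0 subr0 max_l.
apply/funext => v; rewrite /push trimE; case: eqP => // ->.
under eq_bigr do rewrite trimE.
by rewrite -x1 (bigD1 w) //= addrK.
Qed.

Lemma realization_setX x : realization_set R Y x -> support x \in X ->
  realization_set R X x.
Proof. by move=> [x0 x1 _] xX; split. Qed.

Lemma le1_bary x v : (forall v, 0 <= x v) -> \sum_v x v = 1 -> x v <= 1.
Proof.
by move=> x0 <-; rewrite (bigD1 v) //= lerDl; apply: sumr_ge0.
Qed.

Lemma support_push x v : realization_set R Y x ->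
  v \in support (push x) -> v \in w |: support x.
Proof.
move=> [x0 _ _]; rewrite !inE /push; have [//|_ /=] := eqVneq v w.
apply: contra => /eqP xv; rewrite /trim xv sub0r max_r // oppr_le0.
exact: depth_ge0.
Qed.

(** At the stopping time the coordinates outside the witness [s], except that of [w], have vanished,
    so the support without [w] is in [X]. The cone condition then allows [w] to be added. *)
Lemma push_realization x : realization_set R Y x -> realization_set R X (push x).
Proof.
move=> Yx; have [x0 x1 xY] := Yx.
have [XsubY cone] := XY; have /complexP[X0 XS] := cX.
have /complexP[_ YS] := cY.
have sum1 : \sum_(u | u != w) trim x u <= 1.
  rewrite -x1 [leRHS](bigD1 w) //=.
  apply: le_trans (_ : \sum_(u | u != w) x u <= _); last by rewrite lerDr.
  by apply: ler_sum => u _; apply: trim_le.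
split.
- by move=> v; rewrite /push; case: eqP => _; [rewrite subr_ge0|apply: trim_ge0].
- rewrite (bigD1 w) //= {1}/push eqxx.
  rewrite [X in _ + X](eq_bigr (trim x)) ?subrK // => u uw.
  by rewrite /push (negbTE uw).
case: (boolP (support x \in X)) => [xX|xX].
  by rewrite (push_id (realization_setX Yx xX)).
have [s sX sd] := depth_witness (fun v => le1_bary v x0 x1).
have [wxY _] : w |: support x \in Y /\ support x :\ w \in Y :\: X.
  by apply: cone; rewrite inE xX.
pose A := support (push x) :\ w.
have AX : A \in X.
  apply: XS sX _; apply/fintype.subsetP => v; rewrite !inE /push => /andP[vw].
  rewrite (negbTE vw); apply: contraR => vs.
  by rewrite /trim max_r // subr_le0 sd.
have wAX : w |: A \in X.
  (* Were [w |: A] in [Y] but not in [X], removing [w] would give a set outside [X]; but this set is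
     [A]. *)
  apply/negPn/negP => wAX.
  have wAY : w |: A \in Y.
    apply: YS wxY _; rewrite finset.subUset finset.sub1set finset.setU11 /=.
    apply/fintype.subsetP => v /setD1P[vw]; exact: support_push.
  have [_] : w |: (w |: A) \in Y /\ (w |: A) :\ w \in Y :\: X.
    by apply: cone; rewrite inE wAX.
  by rewrite finset.setU1K ?finset.setD11 // inE AX.
apply: XS wAX _; apply/fintype.subsetP => v vp; rewrite in_setU1 in_setD1.
by case: eqP.
Qed.

(** If the support of [x] is in [X] the segment is constant; otherwise both ends have support in
    [w |: support x], one simplex of [Y]. *)
Lemma segment_push_realization (t : R) x : 0 <= t <= 1 ->
  realization_set R Y x ->
  realization_set R Y (fun v => (1 - t) * push x v + t * x v).
Proof.
move=> /andP[t0 t1] Yx; have [x0 x1 xY] := Yx; have [p0 p1 pX] := push_realization Yx.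
have [XsubY cone] := XY; have /complexP[_ YS] := cY.
have t1' : 0 <= 1 - t by rewrite subr_ge0.
split.
- by move=> v; rewrite addr_ge0 // mulr_ge0.
- by rewrite big_split /= -!mulr_sumr p1 x1 !mulr1 subrK.
case: (boolP (support x \in X)) => xX.
  rewrite (push_id (realization_setX Yx xX)).
  suff -> : [set v | (1 - t) * x v + t * x v != 0]%SET = support x by [].
  by apply/setP => v; rewrite !inE -mulrDl subrK mul1r.
have [wxY _] : w |: support x \in Y /\ support x :\ w \in Y :\: X.
  by apply: cone; rewrite inE xX.
apply: YS wxY _; apply/fintype.subsetP => v; rewrite inE => nz.
apply/negPn/negP => vw; case/negP: nz.
have /negbTE pv : v \notin support (push x) by apply: contra vw; apply: support_push.
have /negbTE xv : v \notin support x by apply: contra vw; rewrite !inE => ->; rewrite orbT.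
move: pv xv; rewrite !inE => /negbFE/eqP -> /negbFE/eqP ->.
by rewrite !mulr0 addr0.
Qed.

Lemma push_continuous v :
  continuous (fun x : realization R Y => push (bary x) v).
Proof.
have cdepth : continuous (fun x : realization R Y => depth (bary x)).
  apply: continuousT_bigmin => s _; apply: continuousT_bigmax => u _.
  exact: bary_continuous.
have ctrim u : continuous (fun x : realization R Y => trim (bary x) u).
  apply: continuousT_max; last exact: continuousT_cst.
  exact: continuousT_sub (@bary_continuous _ _ _ u) cdepth.
rewrite /push; case: eqP => _; last exact: ctrim.
apply: continuousT_sub; first exact: continuousT_cst.
by apply: continuousT_sum => u _; apply: ctrim.
Qed.

(** Pushing is a retraction onto the realization of [X], and straight segments join it to the
    identity. *)
Lemma relative_cone_homotopy_equivalent :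
  homotopy_equivalent R (realization R X) (realization R Y).
Proof.
have [XsubY _] := XY.
have incl x : realization_set R X x -> realization_set R Y x.
  by move=> [x0 x1 xX]; split=> //; apply: (fintype.subsetP XsubY).
pose i (x : realization R X) : realization R Y := realization_of (incl _ (baryP x)).
pose r (x : realization R Y) : realization R X :=
  realization_of (push_realization (baryP x)).
have ci : continuous i.
  by apply: realization_continuous => v; apply: bary_continuous.
have cr : continuous r.
  by apply: realization_continuous => v; apply: push_continuous.
exists i, r; split=> //.
  have -> : r \o i = id.
    by apply/funext => x; apply: bary_inj; apply: push_id (baryP x).
  by apply: homotopic_refl; apply: id_continuous.
apply/homotopicP.
pose H (z : R * realization R Y) : realization R Y :=
  realization_of (segment_push_realization (clamp_itv z.1) (baryP z.2)).
exists H; split=> [|x|x].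
- apply: realization_continuous => v.
  have cc : continuous (fun z : R * realization R Y => clamp z.1).
    exact: continuousT_comp (@fst_continuous _ _) (@clamp_continuous R).
  apply: continuousT_add; apply: continuousT_mul.
  + exact: continuousT_sub (@continuousT_cst _ _ _) cc.
  + exact: (continuousT_comp (@snd_continuous _ _) (@push_continuous v)).
  + exact: cc.
  + exact: (continuousT_comp (@snd_continuous _ _) (@bary_continuous _ _ _ v)).
- apply: bary_inj; apply/funext => v /=.
  by rewrite /bary /= clampK ?lexx ?ler01 // subr0 mul1r mul0r addr0.
- apply: bary_inj; apply/funext => v /=.
  by rewrite /bary /= clampK ?lexx ?ler01 // subrr mul1r mul0r add0r.
Qed.

End PushRetraction.

Lemma continuous_row (R : realType) (Z : topologicalType) (n : nat)
    (f : Z -> 'rV[R]_n) :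
  (forall j, continuous (fun z => f z ord0 j)) -> continuous f.
Proof.
move=> cf z A [P HP sub]; apply: filterS sub _.
have : \forall x \near z, forall j, P ord0 j (f x ord0 j).
  by apply: filter_forall => j; apply: cf; apply: HP.
by apply: filterS => x Px i j; rewrite ord1.
Qed.

(** * The boundary of a simplex is a sphere *)

Section BoundarySphere.
Variables (R : realType) (T : finType) (W : {set T}) (n : nat) (w : T).
Implicit Types (x : T -> R) (y : 'rV[R]_n).
Hypotheses (wW : w \in W) (cardW : #|W| = n.+1).

Lemma card_punctured : #|W :\ w| = n.
Proof. by apply/eqP; rewrite -eqSS -cardW (cardsD1 w W) wW. Qed.

Definition face_vertex (j : 'I_n) : T :=
  enum_val (cast_ord (esym card_punctured) j).

Lemma face_vertexP v : v \in W -> v != w -> exists j, face_vertex j = v.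
Proof.
move=> vW vw; have vWw : v \in W :\ w by apply/finset.setD1P.
exists (cast_ord card_punctured (enum_rank_in vWw v)).
by rewrite /face_vertex cast_ordK enum_rankK_in.
Qed.

Lemma face_vertex_inj : injective face_vertex.
Proof. by move=> i j /enum_val_inj/cast_ord_inj. Qed.

Lemma face_vertex_in j : face_vertex j \in W.
Proof. by have := enum_valP (cast_ord (esym card_punctured) j) => /finset.setD1P[]. Qed.

Lemma face_vertex_neq j : face_vertex j != w.
Proof. by have := enum_valP (cast_ord (esym card_punctured) j) => /finset.setD1P[]. Qed.

(* The sphere is matched with directions in R^W modulo constants, normalized by
   giving w the coordinate 0; barycentric coordinates are recovered by
   translating the least coordinate to 0. *)
Definition extend (y : 'rV[R]_n) (v : T) : R :=
  \sum_(j | face_vertex j == v) y ord0 j.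

(** The default 0 is the coordinate of [w], so this is the minimum of [extend y] over all of [W]. *)
Definition low (y : 'rV[R]_n) : R := \big[Num.min/0]_j y ord0 j.

Definition mass (y : 'rV[R]_n) : R := \sum_(v in W) (extend y v - low y).

Definition from_sphere (y : 'rV[R]_n) (v : T) : R :=
  if v \in W then (extend y v - low y) / mass y else 0.

Definition radius (x : T -> R) : R :=
  Num.sqrt (\sum_j (x (face_vertex j) - x w) ^+ 2).

Definition to_sphere (x : T -> R) : 'rV[R]_n :=
  \row_j ((x (face_vertex j) - x w) / radius x).

Lemma extend_face y j : extend y (face_vertex j) = y ord0 j.
Proof.
rewrite /extend (bigD1 j) //= big1 ?addr0 // => i /andP[/eqP ij].
by rewrite (face_vertex_inj ij) eqxx.
Qed.

Lemma extend_base y : extend y w = 0.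
Proof.
by rewrite /extend big1 // => j /eqP jw; have := face_vertex_neq j; rewrite jw eqxx.
Qed.

Lemma low_le y v : v \in W -> low y <= extend y v.
Proof.
move=> vW; have [->|vw] := eqVneq v w; first by rewrite extend_base; apply: bigmin_le_id.
have [j <-] := face_vertexP vW vw; rewrite extend_face.
exact: (@bigmin_le_cond _ _ _ _ j xpredT (fun j => y ord0 j)).
Qed.

Lemma low_attained y : exists2 v, v \in W & extend y v = low y.
Proof.
have /bigmin_leP : low y <= low y by [].
case=> [l0|[j _ jl]].
  by exists w => //; apply/eqP; rewrite eq_le low_le // extend_base l0.
exists (face_vertex j); rewrite ?face_vertex_in //.
by apply/eqP; rewrite eq_le low_le ?face_vertex_in // extend_face jl.
Qed.

(** Zero mass would make all coordinates equal to that of [w], which is 0, whereas [y] is a unit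
    vector. *)
Lemma mass_gt0 y : \sum_j y ord0 j ^+ 2 = 1 -> 0 < mass y.
Proof.
move=> y1; have ge0 v : v \in W -> 0 <= extend y v - low y.
  by move=> vW; rewrite subr_ge0 low_le.
rewrite lt0r sumr_ge0 // andbT; apply/negP => /eqP m0.
have lowE v : v \in W -> extend y v = low y.
  by move=> vW; have /eqP := psumr_eq0P ge0 m0 vW; rewrite subr_eq0 => /eqP.
have l0 : low y = 0 by rewrite -(lowE w wW) extend_base.
move: y1; rewrite big1 => [/esym/eqP|j _]; first by rewrite oner_eq0.
by rewrite -extend_face lowE ?face_vertex_in // l0 expr0n.
Qed.

Lemma from_sphereP y : \sum_j y ord0 j ^+ 2 = 1 ->
  realization_set R (boundary W) (from_sphere y).
Proof.
move=> /mass_gt0 m0; split.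
- move=> v; rewrite /from_sphere; case: ifP => // vW.
  by rewrite divr_ge0 ?subr_ge0 ?low_le // ltW.
- rewrite -big_mkcond /= -mulr_suml divff //; exact: lt0r_neq0.
have [v vW vlow] := low_attained y.
rewrite inE; apply/properP; split.
  by apply/fintype.subsetP => u; rewrite inE /from_sphere; case: ifP => //; rewrite eqxx.
by exists v => //; rewrite inE /from_sphere vW vlow subrr mul0r eqxx.
Qed.

Lemma boundary_zero x : realization_set R (boundary W) x ->
  exists2 v, v \in W & x v = 0.
Proof.
move=> [_ _]; rewrite inE => /properP[_ [v vW]].
by rewrite inE negbK => /eqP; exists v.
Qed.

Lemma boundary_sum x : realization_set R (boundary W) x ->
  \sum_(v in W) x v = 1.
Proof.
move=> [_ <-]; rewrite inE => /andP[/fintype.subsetP xW _].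
rewrite [RHS](bigID (mem W)) /= [X in _ + X]big1 ?addr0 // => v.
by apply: contraNeq => xv; apply: xW; rewrite inE.
Qed.

(** Zero radius would make [x] constant on [W]; one coordinate vanishes on the boundary, so all
    would, against total sum 1. *)
Lemma radius_gt0 x : realization_set R (boundary W) x -> 0 < radius x.
Proof.
move=> Wx; rewrite sqrtr_gt0 lt0r sumr_ge0 ?andbT => [|j _]; last exact: sqr_ge0.
apply/negP => /eqP d0.
have dE v : v \in W -> x v = x w.
  move=> vW; have [->//|vw] := eqVneq v w; have [j <-] := face_vertexP vW vw.
  have /(_ j isT)/eqP := psumr_eq0P (fun j _ => sqr_ge0 (x (face_vertex j) - x w)) d0.
  by rewrite sqrf_eq0 subr_eq0 => /eqP.
have [v vW v0] := boundary_zero Wx.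
have := boundary_sum Wx; rewrite big1 => [/esym/eqP|u uW]; first by rewrite oner_eq0.
by rewrite dE // -(dE v).
Qed.

Lemma to_sphereP x : realization_set R (boundary W) x ->
  \sum_j to_sphere x ord0 j ^+ 2 = 1.
Proof.
move=> Wx; have r0 := radius_gt0 Wx.
under eq_bigr do rewrite mxE expr_div_n.
rewrite -mulr_suml /radius sqr_sqrtr ?divff //; last by apply: sumr_ge0 => j _; apply: sqr_ge0.
by move: r0; rewrite sqrtr_gt0 => /lt0r_neq0.
Qed.

Lemma to_sphereK x : realization_set R (boundary W) x ->
  from_sphere (to_sphere x) = x.
Proof.
move=> Wx; have r0 := radius_gt0 Wx; have [x0 _ xW] := Wx.
have extE v : v \in W -> extend (to_sphere x) v = (x v - x w) / radius x.
  move=> vW; have [->|vw] := eqVneq v w; first by rewrite extend_base subrr mul0r.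
  by have [j <-] := face_vertexP vW vw; rewrite extend_face mxE.
(* The least coordinate of [x] on [W] is 0, being attained at a missing vertex, so the translation
   by [x w] is undone exactly. *)
have lowE : low (to_sphere x) = - x w / radius x.
  apply/eqP; rewrite eq_le; apply/andP; split.
    have [v vW v0] := boundary_zero Wx.
    by have := low_le (to_sphere x) vW; rewrite extE // v0 sub0r.
  have [v vW <-] := low_attained (to_sphere x).
  by rewrite extE // ler_pM2r ?invr_gt0 // lerDr.
have gapE v : v \in W -> extend (to_sphere x) v - low (to_sphere x) = x v / radius x.
  by move=> vW; rewrite extE // lowE -mulrBl opprK subrK.
have massE : mass (to_sphere x) = (radius x)^-1.
  by rewrite /mass (eq_bigr _ gapE) -mulr_suml (boundary_sum Wx) mul1r.
apply/funext => v; rewrite /from_sphere; case: ifPn => vW.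
  by rewrite gapE // massE invrK divfK // lt0r_neq0.
apply/esym/eqP/negPn/negP => xv; case/negP: vW.
by move: xW; rewrite inE => /proper_sub/fintype.subsetP; apply; rewrite inE.
Qed.

Lemma from_sphereK y : \sum_j y ord0 j ^+ 2 = 1 -> to_sphere (from_sphere y) = y.
Proof.
move=> y1; have m0 := mass_gt0 y1.
have dE j : from_sphere y (face_vertex j) - from_sphere y w = y ord0 j / mass y.
  rewrite /from_sphere face_vertex_in wW extend_base extend_face.
  by rewrite -mulrBl opprB addrA subrK subr0.
have rE : radius (from_sphere y) = (mass y)^-1.
  rewrite /radius; under eq_bigr do rewrite dE expr_div_n.
  by rewrite -mulr_suml y1 mul1r -exprVn sqrtr_sqr ger0_norm // invr_ge0 ltW.
apply/rowP => j; rewrite mxE dE rE invrK divfK //; exact: lt0r_neq0.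
Qed.

Lemma to_sphere_continuous j :
  continuous (fun x : realization R (boundary W) => to_sphere (bary x) ord0 j).
Proof.
have cd i : continuous
    (fun x : realization R (boundary W) => bary x (face_vertex i) - bary x w).
  by apply: continuousT_sub; apply: bary_continuous.
have -> : (fun x : realization R (boundary W) => to_sphere (bary x) ord0 j) =
    (fun x : realization R (boundary W) =>
       (bary x (face_vertex j) - bary x w) / radius (bary x)).
  by apply/funext => x; rewrite mxE.
apply: continuousT_mul; first exact: cd.
apply: continuousT_inv => [x|].
  exact/lt0r_neq0/radius_gt0/baryP.
apply: (@continuousT_comp _ _ _ _ Num.sqrt); last exact: sqrt_continuous.
apply: continuousT_sum => i _; exact: continuousT_mul.
Qed.

Definition sphere_coord (y : unit_sphere R n) : 'rV[R]_n := \val y.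

Lemma sphere_coordP (y : unit_sphere R n) :
  \sum_j sphere_coord y ord0 j ^+ 2 = 1.
Proof. exact: set_mem (valP y). Qed.

Lemma from_sphere_continuous v :
  continuous (fun y : unit_sphere R n => from_sphere (sphere_coord y) v).
Proof.
have cy j : continuous (fun y : unit_sphere R n => sphere_coord y ord0 j).
  apply: (@continuousT_comp _ 'rV[R]_n _ sphere_coord (fun M => M ord0 j)).
    exact: initial_continuous.
  exact: coord_continuous.
have cgap u : continuous
    (fun y : unit_sphere R n => extend (sphere_coord y) u - low (sphere_coord y)).
  apply: continuousT_sub; first by apply: continuousT_sum => j _; apply: cy.
  by apply: continuousT_bigmin => j _; apply: cy.
rewrite /from_sphere; case: (v \in W); last exact: continuousT_cst.
apply: continuousT_mul => //; apply: continuousT_inv => [y|].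
  exact/lt0r_neq0/mass_gt0/sphere_coordP.
by apply: continuousT_sum => u _; apply: cgap.
Qed.

Lemma boundary_sphere :
  homotopy_equivalent R (realization R (boundary W)) (unit_sphere R n).
Proof.
pose f (x : realization R (boundary W)) : unit_sphere R n :=
  exist (fun y => y \in [set y : 'rV[R]_n | \sum_(i < n) y ord0 i ^+ 2 = 1]) _
    (mem_set (to_sphereP (baryP x))).
pose g (y : unit_sphere R n) : realization R (boundary W) :=
  realization_of (from_sphereP (sphere_coordP y)).
apply: (@homeomorphic_homotopy_equivalent _ _ _ f g).
- apply: continuous_comp_initial; apply: continuous_row => j.
  exact: to_sphere_continuous.
- by apply: realization_continuous => v; apply: from_sphere_continuous.
- by move=> x; apply: bary_inj; apply: to_sphereK; apply: baryP.
- by move=> y; apply: val_inj; apply: from_sphereK; apply: sphere_coordP.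
Qed.

End BoundarySphere.

(** * Alexander duals as spheres *)

Lemma boundary_homotopy_sphere (R : realType) (T : finType) (V : {set T}) :
  exists n, homotopy_equivalent R (realization R (boundary V)) (unit_sphere R n).
Proof.
(* For empty [V] the boundary is the empty family; its realization and the unit sphere of the
   zero-dimensional space are both empty. *)
have [V0|/finset.set0Pn[w wV]] := eqVneq V finset.set0; last first.
  by exists #|V|.-1; apply: (boundary_sphere _ wV); rewrite prednK // (cardD1 w) wV.
have noL (x : realization R (boundary V)) : False.
  have [_ _] := baryP x; rewrite inE => /properP[_ [v vV _]].
  have : v \in finset.set0 by rewrite -V0.
  by rewrite finset.in_set0.
have noR (y : unit_sphere R 0) : False.
  by have /eqP := sphere_coordP y; rewrite big_ord0 eq_sym oner_eq0.
exists 0%N.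
apply: (@homeomorphic_homotopy_equivalent _ _ _
  (fun x => False_rect _ (noL x)) (fun y => False_rect _ (noR y))).
all: by move=> z; first [case: (noL z)|case: (noR z)].
Qed.

Lemma strong_collapse_dual_sphere (R : realType) (T : finType)
    (K : {set {set T}}) (V X : {set T}) :
  simplicial_complex K -> vertices K \subset V -> (1 < #|X|)%N ->
  strong_collapse K (boundary X) ->
  exists n, homotopy_equivalent R (realization R (alexander_dual V K))
              (unit_sphere R n).
Proof.
move=> cK + X1 KX; move: K cK KX.
(* The induction also carries [vertices K \notin K]: it yields [V \notin K], which makes every dual
   along the way a simplicial complex. *)
suff H : forall K, simplicial_complex K -> strong_collapse K (boundary X) ->
    vertices K \notin K /\ (vertices K \subset V ->
      exists n, homotopy_equivalent R (realization R (alexander_dual V K))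
                  (unit_sphere R n)).
  by move=> K cK KX; have [_] := H K cK KX.
have notinV K : simplicial_complex K -> vertices K \subset V ->
    vertices K \notin K -> V \notin K.
  by move=> /complexP[_ KS] KV; apply: contra => /KS; apply.
apply: strong_collapse_rev_ind => [cX|K v w cK vK dom _ [K'n K'S]].
  rewrite vertices_boundary X1 inE fintype.properxx; split=> // XV.
  have /finset.set0Pn[w wX] : X != finset.set0 by rewrite -card_gt0 (ltn_trans _ X1).
  have VX : V \notin boundary X by rewrite inE properE XV andbF.
  have [n Sn] := boundary_homotopy_sphere R (w |: V :\: X)%SET.
  exists n; apply: homotopy_equivalent_trans Sn; apply: homotopy_equivalent_sym.
  apply: (relative_cone_homotopy_equivalent R _ (alexander_dual_complex cX VX)).
    by apply: boundary_complex; apply/finset.set0Pn; exists w; rewrite finset.setU11.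
  exact: boundary_dual_relative_cone.
have Kn := deletion_vertices_notin cK K'n.
split=> // KV; have VK := notinV K cK KV Kn.
have cK' := deletion_complex v cK.
have K'V : vertices (deletion v K) \subset V.
  apply: fintype.subset_trans KV; apply/fintype.subsetP => u.
  by rewrite !inE => /andP[].
have [n Sn] := K'S K'V; exists n; apply: homotopy_equivalent_trans Sn.
apply: (relative_cone_homotopy_equivalent R (alexander_dual_complex cK VK)).
  exact: alexander_dual_complex cK' (notinV _ cK' K'V K'n).
exact: alexander_dual_relative_cone cK KV vK dom.
Qed.

Theorem corollary2p9 (R : realType) (T : finType) (K : {set {set T}})
    (V : {set T}) (S : finType) (sigma : {set S})
    (hK : simplicial_complex K)
    (hV : vertices K \subset V)
    (hN : strong_collapses_to (nerve K) (boundary sigma)) :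
  collapses_to K (boundary sigma) /\
  exists n : nat,
    homotopy_equivalent R (realization R (alexander_dual V K))
      (unit_sphere R n).
Proof.
have [[-> s1]|[X [KX X1 Xs]]] := strong_collapse_boundary hK hN.
  (* Here [K] has only the empty simplex, so its dual is the boundary of [V] itself. *)
  split; last by rewrite alexander_dual_set0; apply: boundary_homotopy_sphere.
  by eexists; [exact: connect0|exact: set0_isomorphic_boundary].
split; last exact: strong_collapse_dual_sphere hK hV X1 KX.
exists (boundary X); first exact: strong_collapse_simplicial.
exact: boundary_isomorphic.
Qed.
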